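(* For all integers $n\geq 0$ and $0\leq k\leq \lfloor n/2\rfloor$, $$S(n,k)=\#\{\pi\in\mathcal{BS}_{n+2}: \mathrm{des}(\pi)=k+1\}.$$ Equivalently, for all $n\ge 0$, $$S_n(x)=\sum_{\pi\in\mathcal{BS}_{n+2}}x^{\mathrm{des}(\pi)-1}.$$
   Context: Let $\mathfrak{S}_n$ be the set of permutations of $[n]=\{1,\dots,n\}$, written as words $\pi=\pi(1)\pi(2)\cdots\pi(n)$. A descent of a word $w(1)\cdots w(m)$ of distinct integers is an index $i\in[m-1]$ with $w(i)>w(i+1)$; $\mathrm{des}(\pi)$ is the number of descents of $\pi$. A double descent is an index $i\in[m-2]$ with $w(i)>w(i+1)>w(i+2)$. A succession is an index $i\in[m-1]$ with $w(i+1)=w(i)+1$. For $\pi\in\mathfrak{S}_n$ and $k\in[n]$, the subword of $\pi$ restricted to $[k]$ is the word formed by the letters $1,\dots,k$ in the order in which they appear in $\pi$. A permutation $\pi\in\mathfrak{S}_n$ is simsun if for all $k\in[n]$ the subword of $\pi$ restricted to $[k]$ contains no double descents. $\mathcal{RS}_n$ denotes the set of simsun permutations in $\mathfrak{S}_n$. The number $S(n,k)$ is the number of $\pi\in\mathcal{RS}_n$ with $\mathrm{des}(\pi)=k$ (with $S(0,0)=1$ and $S(0,k)=0$ for $k\ge1$), and $S_n(x)=\sum_{\pi\in\mathcal{RS}_n}x^{\mathrm{des}(\pi)}=\sum_{k=0}^{\lfloor n/2\rfloor}S(n,k)x^k$, with $S_0(x)=1$. $\mathcal{BS}_n$ denotes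 the set of permutations $\pi\in\mathcal{RS}_n$ such that for all $k\in[n]$ the subword of $\pi$ restricted to $[k]$ contains no successions. For example, $\mathcal{BS}_2=\{21\}$ and $\mathcal{BS}_5=\{25143,21435,24135,24153,52413\}$. *)

(* Defs.v *)
From mathcomp Require Import all_boot all_fingroup all_algebra.

Set Implicit Arguments.
Unset Strict Implicit.
Unset Printing Implicit Defensive.

Import GRing.Theory.

(* Words are sequences of naturals; the position i of the mathematics is the
   index i - 1 of the sequence, so i ranges over iota 0 (size w).-1 below. *)
Definition des (w : seq nat) : nat :=
  count (fun i => nth 0 w i > nth 0 w i.+1) (iota 0 (size w).-1).

Definition has_double_descent (w : seq nat) : bool :=
  has (fun i => nth 0 w i.+2 < nth 0 w i.+1 < nth 0 w i)
      (iota 0 (size w).-2).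

Definition has_succession (w : seq nat) : bool :=
  has (fun i => nth 0 w i.+1 == (nth 0 w i).+1) (iota 0 (size w).-1).

Definition restrict (k : nat) (w : seq nat) : seq nat :=
  [seq x <- w | 1 <= x <= k].

Definition simsun (n : nat) (w : seq nat) : bool :=
  all (fun k => ~~ has_double_descent (restrict k w)) (iota 1 n).

Definition succession_free (n : nat) (w : seq nat) : bool :=
  all (fun k => ~~ has_succession (restrict k w)) (iota 1 n).

(* A permutation of {0, ..., n-1} read as a word in the letters 1, ..., n. *)
Definition word (n : nat) (p : 'S_n) : seq nat :=
  [seq (p i : nat).+1 | i <- enum 'I_n].

Definition RS (n : nat) : {set 'S_n} := [set p : 'S_n | simsun n (word p)].

Definition BS (n : nat) : {set 'S_n} :=
  [set p in RS n | succession_free n (word p)].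

(* For n = 0 the only word is the empty one, so this gives S(0,0) = 1 and
   S(0,k) = 0 for k >= 1. *)
Definition simsun_number (n k : nat) : nat :=
  #|[set p in RS n | des (word p) == k]|.

Definition simsun_poly (n : nat) : {poly int} :=
  (\sum_(p in RS n) 'X^(des (word p)))%R.

Lemma perm_word n (p : 'S_n) : perm_eq (word p) (iota 1 n).
Proof.
apply: uniq_perm; rewrite ?iota_uniq //.
  rewrite map_inj_uniq ?enum_uniq // => i j [] /val_inj; exact: perm_inj.
move=> x; rewrite mem_iota add1n ltnS; apply/mapP/idP=> [[i _ ->]|].
  by rewrite /= ltn_ord.
case: x => // x /= lt_xn; exists (p^-1%g (Ordinal lt_xn)).
  by rewrite mem_enum.
by rewrite permKV.
Qed.

(* Hence the truncated exponent (des (word p)).-1 is a genuine des - 1 as soon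
   as p lies in BS n with n >= 2. *)
Lemma des_BS_gt0 n (p : 'S_n.+2) : p \in BS n.+2 -> 0 < des (word p).
Proof.
rewrite !inE => /andP[_ sf]; rewrite lt0n; apply: contraL sf => /eqP des0.
have srt : sorted ltn (word p).
  apply/(sortedP 0) => i lt_i.
  have lt_i' : i < (size (word p)).-1 by case: (size _) lt_i.
  have /hasPn/(_ i) : ~~ has (fun i => nth 0 (word p) i > nth 0 (word p) i.+1)
      (iota 0 (size (word p)).-1) by rewrite has_count -lt0n -/(des _) des0.
  rewrite mem_iota add0n lt_i' => /(_ isT); rewrite -leqNgt leq_eqVlt.
  case/orP=> [|//]; rewrite nth_uniq ?(ltnW lt_i) //.
    by rewrite ltn_eqF.
  by rewrite (perm_uniq (perm_word p)) iota_uniq.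
have -> : word p = iota 1 n.+2.
  apply: (sorted_eq ltn_trans _ srt (iota_ltn_sorted _ _) (perm_word p)).
  by move=> x y /andP[xy yx]; move: (ltn_trans xy yx); rewrite ltnn.
apply/allPn; exists 2; first by rewrite mem_iota.
rewrite negbK /restrict /=.
by have -> : [seq x <- iota 3 n | 0 < x <= 2] = [::];
  [apply/eqP; rewrite -(negbK (_ == _)) -has_filter; apply/hasPn => x;
   rewrite mem_iota => /andP[lt2x _]; rewrite negb_and -!ltnNge lt2x orbT |].
Qed.

(* Main.v *)
Require Import Defs.
From mathcomp Require Import all_boot all_fingroup all_algebra.

Set Implicit Arguments.
Unset Strict Implicit.
Unset Printing Implicit Defensive.

Import GRing.Theory.

(** Both families grow by inserting the next largest letter N into a word w of
size m with d descents; in both, the longer word is admissible exactly when w is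
admissible and the insertion creates no forbidden pattern.

Inserting N just before the bottom b of a descent a > b, or at the end of w,
keeps the number of descents; this can be done in d + 1 gaps, none of which
creates a double descent when w has none.  Any other gap adds one descent, and
a double descent appears exactly when the letter that follows N starts a
descent of w; since no double descent occurs in w, the d gaps before descent
tops are disjoint from the d gaps inside descents, which leaves m - 2d gaps
([card_keep_gaps], [card_add_gaps]).  So a simsun word of size m has d + 1
simsun children with d descents and m - 2d with d + 1 descents.

Excluding successions forbids one more gap, the one right after the current
largest letter ([has_succession_insert]).  That letter either ends the word or
is a descent top, so the lost gap is always one of those that keep d, and a
word has d children with d descents and m - 2d with d + 1 ([sum_BS_insert]).
With m = n + 2 and d = e + 1 descents these are e + 1 and n - 2e, the
numbers for a simsun word of size n with e descents.  Since the two
generating trees start from one word each, with e = 0 and d = 1, the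
distribution of des + 1 on simsun words of size n is that of des on
succession-free ones of size n + 2 ([sum_simsun_BS]).

The distributions are compared by summing an arbitrary weight F of the number
of descents with values in a commutative monoid: a change of weight absorbs
the recurrence, so that the induction needs no coefficient bookkeeping, and
the numbers and the polynomials are two choices of F. *)

(** * Local patterns of a word *)

Definition descent_at (w : seq nat) (i : nat) : bool :=
  (i.+1 < size w) && (nth 0 w i.+1 < nth 0 w i).

Definition succession_at (w : seq nat) (i : nat) : bool :=
  (i.+1 < size w) && (nth 0 w i.+1 == (nth 0 w i).+1).

Lemma desE w : des w = \sum_(i < size w) descent_at w i.
Proof.
rewrite /des -sum1_count big_mkcond /= -{1}[(size w).-1]subn0 big_mkord.
case: (posnP (size w)) => [->|]; first by rewrite !big_ord0.
rewrite /descent_at; case: (size w) => //= n _.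
rewrite big_ord_recr /= ltnn addn0; apply: eq_bigr => i _.
by rewrite ltnS ltn_ord; case: ifP.
Qed.

Lemma has_double_descentP w :
  reflect (exists i, descent_at w i && descent_at w i.+1)
          (has_double_descent w).
Proof.
apply: (iffP hasP) => [[i]|[i /andP[/andP[_ d1] /andP[lt d2]]]].
  rewrite mem_iota add0n => /= lt_i /andP[d2 d1]; exists i.
  by rewrite !ltn_predRL in lt_i; rewrite /descent_at d1 d2 lt_i ltnW.
by exists i; rewrite ?d1 ?d2 // mem_iota !ltn_predRL.
Qed.

Lemma has_successionP w :
  reflect (exists i, succession_at w i) (has_succession w).
Proof.
apply: (iffP hasP) => [[i]|[i /andP[lt s]]].
  rewrite mem_iota add0n => /= lt_i s; exists i.
  by rewrite /succession_at s -ltn_predRL lt_i.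
by exists i; rewrite // mem_iota ltn_predRL.
Qed.

(** * Inserting a new largest letter *)

Definition insert (g N : nat) (w : seq nat) : seq nat :=
  take g w ++ N :: drop g w.

Lemma size_insert g N w : size (insert g N w) = (size w).+1.
Proof. by rewrite size_cat /= addnS -size_cat cat_take_drop. Qed.

Lemma nth_insert g N w i : g <= size w ->
  nth 0 (insert g N w) i =
    if i < g then nth 0 w i else if i == g then N else nth 0 w i.-1.
Proof.
move=> le_g; rewrite nth_cat size_takel //.
case: ltngtP => [lt|lt|->]; rewrite ?subnn //; first exact: nth_take.
case: i lt => // i; rewrite ltnS => le.
by rewrite subSn //= nth_drop subnKC.
Qed.

Section InsertLargest.

Variables (w : seq nat) (N : nat).
Hypothesis ltN : all (ltn^~ N) w.

Let nth_lt i : i < size w -> nth 0 w i < N.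
Proof. by move=> lt; exact: (allP ltN) (mem_nth 0 lt). Qed.

(** The new letter sits at index [g] and [bump g] enumerates the old indices, so
this lemma and the next one give all the descents after an insertion. *)
Lemma descent_at_insert g : g <= size w ->
  descent_at (insert g N w) g = (g < size w).
Proof.
move=> le_g; rewrite /descent_at size_insert ltnS !nth_insert //.
rewrite ltnn eqxx [g.+1 < g]ltnNge leqnSn /= gtn_eqF //=.
by have [lt|//] := boolP (g < size w); rewrite nth_lt.
Qed.

Lemma descent_at_insert_bump g j : g <= size w ->
  descent_at (insert g N w) (bump g j) = descent_at w j && (j.+1 != g).
Proof.
move=> le_g; rewrite /descent_at size_insert !nth_insert // /bump.
have [le|lt] := leqP g j.
  rewrite add1n ltnS [j.+1 < g]ltnNge [j.+2 < g]ltnNge.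
  rewrite (leqW le) (leqW (leqW le)) /= !gtn_eqF ?andbT //.
  by rewrite ltnS ltnW.
rewrite add0n lt; have [<-|ne] := eqVneq j.+1 g.
  rewrite ltnn andbF; apply/negP => /andP[_].
  by rewrite ltnNge ltnW // nth_lt // (leq_trans lt).
have lt' : j.+1 < g by rewrite ltn_neqAle ne.
by rewrite lt' (leq_trans lt' le_g) ltnS (leq_trans lt le_g) andbT.
Qed.

(** The new letter exceeds its left neighbour, so it can only be the top of a
double descent; the rest of that pattern is then a descent of [w] at [g]. *)
Lemma has_double_descent_insert g : ~~ has_double_descent w ->
  g <= size w -> has_double_descent (insert g N w) = descent_at w g.
Proof.
move=> nodd le_g; apply/has_double_descentP/idP => [[i]|dg]; last first.
  have /andP[/ltnW lt_g _] := dg.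
  exists g; rewrite descent_at_insert // lt_g /=.
  have -> : g.+1 = bump g g by rewrite /bump leqnn.
  by rewrite descent_at_insert_bump // dg neq_ltn ltnSn orbT.
have bump_ge j : g <= j -> j.+1 = bump g j by rewrite /bump => ->.
have bump_lt j : j < g -> j = bump g j by rewrite /bump ltnNge => /negbTE->.
have dd_w j : descent_at w j && descent_at w j.+1 = false.
  by apply/negP => dd; case/negP: nodd; apply/has_double_descentP; exists j.
(* Away from index g, a double descent of the longer word is one of w. *)
have [lt|gt|->] := ltngtP i g.
- rewrite {1}(bump_lt i lt) descent_at_insert_bump //.
  have [->|ne] := eqVneq i.+1 g; first by rewrite andbF.
  rewrite (bump_lt i.+1) ?descent_at_insert_bump //; last by rewrite ltn_neqAle ne.
  by rewrite andbT andbA dd_w.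
- case: i gt => // i ge; rewrite (bump_ge i.+1) ?leqW // {1}(bump_ge i) //.
  by rewrite !descent_at_insert_bump // andbAC andbA dd_w.
- by rewrite (bump_ge g) // descent_at_insert_bump // => /and3P[].
Qed.

(** A descent across the gap is destroyed and the new letter is a descent top
unless it comes last: the two effects cancel inside a descent. *)
Lemma des_insert g : g <= size w ->
  des (insert g N w) =
    des w + ((g < size w) && ~~ ((0 < g) && descent_at w g.-1)).
Proof.
move=> le_g; set prev := (0 < g) && _.
have prev_lt : prev -> g < size w by case: (g) @prev => //= ? /andP[].
have: des w = \sum_(j < size w) (descent_at w j && (j.+1 != g)) + prev.
  rewrite desE /prev; have [->|g_gt0] := posnP g.
    by rewrite addn0; apply: eq_bigr => j _; rewrite andbT.
  have lt_g : g.-1 < size w by rewrite prednK.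
  rewrite (bigD1 (Ordinal lt_g)) // [X in _ = X + _](bigD1 (Ordinal lt_g)) //=.
  rewrite prednK // eqxx andbF add0n addnC; congr (_ + _).
  apply: eq_bigr => j; rewrite -val_eqE /= => ne.
  by rewrite -[g in _ != g]prednK // eqSS ne andbT.
move=> ->; rewrite desE size_insert.
rewrite (bigD1_ord (Ordinal (le_g : g < (size w).+1))) //=.
rewrite descent_at_insert // addnC -addnA; congr (_ + _).
  by apply: eq_bigr => j _; rewrite descent_at_insert_bump.
by case: (prev) prev_lt => [->|]; rewrite ?andbT.
Qed.

End InsertLargest.

Lemma words_lt n w : perm_eq w (iota 1 n) -> all (ltn^~ n.+1) w.
Proof.
by move=> pw; apply/allP => x; rewrite (perm_mem pw) mem_iota add1n => /andP[].
Qed.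

(** The new maximum [n.+2] has no successor in the word and can only break old
successions, so it creates one only by following [n.+1]. *)
Lemma has_succession_insert g n w : perm_eq w (iota 1 n.+1) ->
  ~~ has_succession w -> g <= size w ->
  has_succession (insert g n.+2 w) = (g == (index n.+1 w).+1).
Proof.
move=> pw nosucc le_g.
have max_w : n.+1 \in w by rewrite (perm_mem pw) mem_iota add1n leqnn.
have uniq_w : uniq w by rewrite (perm_uniq pw) iota_uniq.
have suc_w j : succession_at w j = false.
  by apply/negP => sc; case/negP: nosucc; apply/has_successionP; exists j.
apply/has_successionP/eqP => [[i]|g_def].
  rewrite /succession_at size_insert ltnS => /andP[lt_i].
  have lt_w j : nth 0 w j == n.+3 = false.
    have [lt|ge] := ltnP j (size w); last by rewrite nth_default.
    have := mem_nth 0 lt; rewrite (perm_mem pw) mem_iota add1n => /andP[_ lt'].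
    by rewrite ltn_eqF // ltnW.
  rewrite !nth_insert //; have [lt|gt|<-] := ltngtP i.+1 g.
  - move=> sc; have /idP[] := negbT (suc_w i).
    by rewrite /succession_at sc (leq_trans lt).
  - rewrite ltnS in gt; rewrite /=; have [_|ne] := eqVneq i g.
      by rewrite lt_w.
    case: i lt_i gt ne => [|i] lt_i; first by rewrite leqn0 eq_sym => ->.
    by move=> _ _ sc; have := suc_w i; rewrite /succession_at sc lt_i.
  - by rewrite eqSS => /eqP->; rewrite index_uniq.
exists (index n.+1 w); rewrite /succession_at size_insert ltnS index_mem max_w.
by rewrite !nth_insert // g_def ltnn ltnSn nth_index //= !eqxx.
Qed.

(** * Counting the gaps *)

Definition follows_descent (w : seq nat) (g : nat) : bool :=
  (0 < g) && descent_at w g.-1.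

Definition adds_descent (w : seq nat) (g : nat) : bool :=
  (g < size w) && ~~ follows_descent w g.

Lemma sum_follows_descent w :
  \sum_(g < size w) follows_descent w g = des w.
Proof.
rewrite desE /follows_descent.
case sw: (size w) => [|m]; first by rewrite !big_ord0.
rewrite big_ord_recl [RHS]big_ord_recr /= add0n.
by rewrite /descent_at sw ltnn addn0.
Qed.

(** The [des w] gaps inside descents, together with the end of the word. *)
Lemma card_keep_gaps w :
  #|[pred g : 'I_(size w).+1 | ~~ adds_descent w g]| = (des w).+1.
Proof.
rewrite -sum1_card big_mkcond big_ord_recr /= /adds_descent inE ltnn /= addn1.
congr _.+1; rewrite -sum_follows_descent; apply: eq_bigr => g _.
by rewrite inE /= ltn_ord negbK; case: follows_descent.
Qed.

(** If gap [g] precedes a descent top, the letter before it is not a descent top,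
for otherwise [w] would have a double descent. *)
Lemma descent_not_adds w g : ~~ has_double_descent w ->
  descent_at w g -> adds_descent w g.
Proof.
move=> nodd dg; rewrite /adds_descent; have /andP[/ltnW-> _] := dg.
apply: contra nodd => /andP[g_gt0 dp].
by apply/has_double_descentP; exists g.-1; rewrite dp prednK.
Qed.

(** Among the [size w] gaps other than the end, [des w] lie inside a descent and
[des w] precede a descent top; these are disjoint by [descent_not_adds]. *)
Lemma card_add_gaps w : ~~ has_double_descent w ->
  #|[pred g : 'I_(size w).+1 | ~~ descent_at w g && adds_descent w g]|
    = size w - (des w).*2.
Proof.
move=> nodd.
pose free g := ~~ descent_at w g && ~~ follows_descent w g.
have -> : #|[pred g : 'I_(size w).+1 | ~~ descent_at w g && adds_descent w g]|
    = \sum_(g < size w) free g.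
  rewrite -sum1_card big_mkcond big_ord_recr /= inE.
  rewrite /adds_descent ltnn andbF addn0; apply: eq_bigr => g _.
  by rewrite inE /= ltn_ord -/(free g); case: free.
apply: (canRL (addnK _)); rewrite -addnn {1}desE -sum_follows_descent.
rewrite -!big_split /= -[RHS]card_ord -sum1_card; apply: eq_bigr => g _.
have := descent_not_adds nodd (g := g); rewrite /adds_descent /free.
by case: descent_at => [/(_ isT)/andP[_]|_]; case: follows_descent.
Qed.

Section GapSums.

Variables (V : nmodType) (F : nat -> V).

Lemma sum_des_insert w N (A : pred 'I_(size w).+1) : all (ltn^~ N) w ->
  (\sum_(g < (size w).+1 | A g) F (des (insert g N w)) =
   F (des w) *+ #|[pred g | A g & ~~ adds_descent w (g : 'I__)]|
   + F (des w).+1 *+ #|[pred g | A g & adds_descent w (g : 'I__)]|)%R.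
Proof.
move=> ltN; rewrite (bigID (fun g : 'I__ => adds_descent w g)) /= addrC -!sumr_const.
have le_g (g : 'I_(size w).+1) : g <= size w by rewrite -ltnS.
congr (_ + _)%R; apply: eq_bigr => g /andP[_ ad]; rewrite des_insert //.
  by rewrite -/(follows_descent w g) -/(adds_descent w g) (negbTE ad) addn0.
by rewrite -/(follows_descent w g) -/(adds_descent w g) ad addn1.
Qed.

Lemma sum_simsun_insert w N : all (ltn^~ N) w -> ~~ has_double_descent w ->
  (\sum_(g < (size w).+1 | ~~ has_double_descent (insert g N w))
      F (des (insert g N w)) =
   F (des w) *+ (des w).+1 + F (des w).+1 *+ (size w - (des w).*2))%R.
Proof.
move=> ltN nodd; rewrite sum_des_insert // -card_keep_gaps -card_add_gaps //.
have dd (g : 'I_(size w).+1) : has_double_descent (insert g N w) = descent_at w g.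
  by rewrite has_double_descent_insert // -ltnS.
congr (_ *+ _ + _ *+ _)%R; apply: eq_card => g; rewrite !inE dd //.
by case: (boolP (descent_at w g)) => // /(descent_not_adds nodd)->.
Qed.

(** One gap fewer than in [sum_simsun_insert], and always among those that keep
the number of descents. *)
Lemma sum_BS_insert w n : perm_eq w (iota 1 n.+1) ->
  ~~ has_double_descent w -> ~~ has_succession w ->
  (\sum_(g < (size w).+1 | ~~ has_double_descent (insert g n.+2 w) &&
                           ~~ has_succession (insert g n.+2 w))
      F (des (insert g n.+2 w)) =
   F (des w) *+ des w + F (des w).+1 *+ (size w - (des w).*2))%R.
Proof.
move=> pw nodd nosucc.
have ltN := words_lt pw.
have max_w : n.+1 \in w by rewrite (perm_mem pw) mem_iota add1n leqnn.
have lt_ix : (index n.+1 w).+1 < (size w).+1 by rewrite ltnS index_mem.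
pose g0 := Ordinal lt_ix.
(* The maximum of w is its last letter or a descent top. *)
have keep_g0 : ~~ adds_descent w g0.
  rewrite /adds_descent /follows_descent /descent_at /=.
  case: (ltnP _.+1 (size w)) => //= lt; rewrite negbK nth_index //.
  have := mem_nth 0 lt; rewrite (perm_mem pw) mem_iota add1n ltnS => /andP[_].
  rewrite leq_eqVlt => /orP[/eqP eq_max|//].
  have uniq_w : uniq w by rewrite (perm_uniq pw) iota_uniq.
  by have := index_uniq 0 lt uniq_w; rewrite eq_max => /n_Sn.
have dd (g : 'I_(size w).+1) :
    has_double_descent (insert g n.+2 w) = descent_at w g.
  by rewrite has_double_descent_insert // -ltnS.
have sc (g : 'I_(size w).+1) : has_succession (insert g n.+2 w) = (g == g0).
  by rewrite (has_succession_insert pw) // -ltnS.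
rewrite sum_des_insert // -card_add_gaps //.
(* The count of keeping gaps, from which g0 is then removed. *)
have -> : des w = (des w).+1.-1 by []; rewrite -card_keep_gaps.
rewrite (cardD1 g0) inE keep_g0 /=.
congr (_ *+ _ + _ *+ _)%R; last 1 first.
apply: eq_card => g; rewrite !inE dd sc.
  by have [->|] := eqVneq g g0; rewrite ?(negbTE keep_g0) ?andbF ?andbT.
apply: eq_card => g; rewrite !inE dd sc.
by case: (boolP (descent_at w g)) => [/(descent_not_adds nodd)->|]; rewrite ?andbF.
Qed.

End GapSums.

(** * Recurrences over all words *)

Definition words (n : nat) : seq (seq nat) := permutations (iota 1 n).

Lemma mem_words n w : (w \in words n) = perm_eq w (iota 1 n).
Proof. exact: mem_permutations. Qed.

Lemma restrict_insert k g n w : k <= n ->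
  restrict k (insert g n.+1 w) = restrict k w.
Proof.
move=> le_kn; rewrite /restrict filter_cat /= [n < k]ltnNge le_kn /=.
by rewrite -filter_cat cat_take_drop.
Qed.

Lemma perm_insert g n w : perm_eq w (iota 1 n) ->
  perm_eq (insert g n.+1 w) (iota 1 n.+1).
Proof.
move=> pw; rewrite -addn1 iotaD add1n addn1 perm_sym perm_catC /= perm_sym.
by rewrite /insert perm_catC /= perm_cons perm_catC cat_take_drop.
Qed.

Lemma restrict_full n w : perm_eq w (iota 1 n) -> restrict n w = w.
Proof.
move=> pw; apply/all_filterP/allP => x.
by rewrite (perm_mem pw) mem_iota add1n ltnS.
Qed.

(** The restriction to [k <= n] forgets the letter [n.+1], and the restriction to
[n.+1] is the whole word, so each insertion adds a single test. *)
Lemma all_restrict_insert (P : pred (seq nat)) g n w : perm_eq w (iota 1 n) ->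
  all (fun k => P (restrict k (insert g n.+1 w))) (iota 1 n.+1) =
  all (fun k => P (restrict k w)) (iota 1 n) && P (insert g n.+1 w).
Proof.
move=> pw; rewrite -addn1 iotaD all_cat add1n /= andbT addn1.
rewrite (restrict_full (perm_insert g pw)); congr (_ && _).
apply: eq_in_all => k; rewrite mem_iota add1n ltnS => /andP[_ le_kn].
by rewrite restrict_insert.
Qed.

Lemma all_restrict_last (P : pred (seq nat)) n w : perm_eq w (iota 1 n.+1) ->
  all (fun k => P (restrict k w)) (iota 1 n.+1) -> P w.
Proof.
by move=> pw /allP/(_ n.+1); rewrite restrict_full // mem_iota add1n leqnn; apply.
Qed.

Lemma simsun_insert g n w : perm_eq w (iota 1 n) ->
  simsun n.+1 (insert g n.+1 w) =
    simsun n w && ~~ has_double_descent (insert g n.+1 w).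
Proof. exact: (all_restrict_insert (fun w => ~~ has_double_descent w)). Qed.

Lemma succession_free_insert g n w : perm_eq w (iota 1 n) ->
  succession_free n.+1 (insert g n.+1 w) =
    succession_free n w && ~~ has_succession (insert g n.+1 w).
Proof. exact: (all_restrict_insert (fun w => ~~ has_succession w)). Qed.

(** Every word is obtained by an insertion, and there are only [n.+1 * n`!] pairs
(word, gap): counting yields the bijection without injectivity of [insert]. *)
Lemma perm_words_insert n :
  perm_eq (words n.+1) [seq insert g n.+1 w | w <- words n, g <- iota 0 n.+1].
Proof.
set s := [seq _ | _ <- _, _ <- _].
have sub : {subset words n.+1 <= s}.
  move=> w; rewrite mem_words => pw.
  have max_w : n.+1 \in w by rewrite (perm_mem pw) mem_iota add1n leqnn.
  case/splitPr: max_w pw => s1 s2 pw.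
  have pw' : perm_eq (s1 ++ s2) (iota 1 n).
    move: pw; rewrite -[X in iota _ X]addn1 iotaD add1n perm_catC /= perm_sym.
    by rewrite perm_catC /= perm_cons perm_sym perm_catC.
  apply/allpairsP; exists (s1 ++ s2, size s1); split;
    rewrite ?mem_words ?mem_iota //=.
    rewrite ltnS -[n in _ <= n](size_iota 1) -(perm_size pw').
    by rewrite size_cat leq_addr.
  by rewrite /insert take_size_cat // drop_size_cat.
have size_s : size s <= size (words n.+1).
  rewrite size_allpairs /words !size_permutations ?iota_uniq //.
  by rewrite !size_iota factS mulnC.
have uniq_words := permutations_uniq (iota 1 n.+1).
apply: uniq_perm => //; first exact: leq_size_uniq sub size_s.
by have [] := uniq_min_size uniq_words sub size_s.
Qed.

Section Recurrences.

Variables (V : nmodType) (F : nat -> V).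

Lemma sum_words_insert n (G : seq nat -> V) :
  (\sum_(w <- words n.+1) G w =
   \sum_(w <- words n) \sum_(g < n.+1) G (insert g n.+1 w))%R.
Proof.
rewrite (perm_big _ (perm_words_insert n)) big_allpairs_dep.
apply: eq_bigr => w _.
by rewrite -(big_mkord xpredT (fun g => G (insert g n.+1 w))) /index_iota subn0.
Qed.

Lemma sum_simsun_rec n :
  (\sum_(w <- words n.+1 | simsun n.+1 w) F (des w) =
   \sum_(w <- words n | simsun n w)
      (F (des w) *+ (des w).+1 + F (des w).+1 *+ (n - (des w).*2)))%R.
Proof.
rewrite big_mkcond sum_words_insert [RHS]big_mkcond /=.
apply: eq_big_seq => w; rewrite mem_words => pw.
have sw : size w = n by rewrite (perm_size pw) size_iota.
under eq_bigr => g _ do rewrite simsun_insert //.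
case: ifP => [sim|_]; last by rewrite big1.
have nodd : ~~ has_double_descent w.
  case: n sw pw sim => [/size0nil->//|n _ pw].
  exact: (@all_restrict_last (fun w => ~~ has_double_descent w)).
by rewrite -big_mkcond; have := sum_simsun_insert F (words_lt pw) nodd; rewrite sw.
Qed.

Lemma sum_BS_rec n :
  (\sum_(w <- words n.+2 | simsun n.+2 w && succession_free n.+2 w) F (des w) =
   \sum_(w <- words n.+1 | simsun n.+1 w && succession_free n.+1 w)
      (F (des w) *+ des w + F (des w).+1 *+ (n.+1 - (des w).*2)))%R.
Proof.
rewrite big_mkcond sum_words_insert [RHS]big_mkcond /=.
apply: eq_big_seq => w; rewrite mem_words => pw.
have sw : size w = n.+1 by rewrite (perm_size pw) size_iota.
under eq_bigr => g _ do
  rewrite simsun_insert // succession_free_insert // andbACA.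
case: ifP => [/andP[sim sf]|_]; last by rewrite big1.
have nodd : ~~ has_double_descent w.
  exact: (@all_restrict_last (fun w => ~~ has_double_descent w)) sim.
have nosucc : ~~ has_succession w.
  exact: (@all_restrict_last (fun w => ~~ has_succession w)) sf.
by rewrite -big_mkcond; have := sum_BS_insert F pw nodd nosucc; rewrite sw.
Qed.

End Recurrences.

(** The induction is on [n] with [F] arbitrary, as each recurrence replaces [F] by
another weight; comparing [F] at [des + 1] with [F] at [des] makes the two new
weights agree, by [n.+2 - (d.+1).*2 = n - d.*2]. *)
Lemma sum_simsun_BS (V : nmodType) n (F : nat -> V) :
  (\sum_(w <- words n | simsun n w) F (des w).+1 =
   \sum_(w <- words n.+2 | simsun n.+2 w && succession_free n.+2 w) F (des w))%R.
Proof.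
elim: n F => [|n IHn] F.
  (* The base words are the empty one and 21, the latter as child of 1. *)
  rewrite sum_BS_rec !big_cons !big_nil /= !addr0.
  by rewrite mulr0n add0r mulr1n.
rewrite sum_BS_rec.
rewrite -(IHn (fun d => F d *+ d + F d.+1 *+ (n.+2 - d.*2))%R).
rewrite (sum_simsun_rec (fun d => F d.+1)).
by apply: eq_bigr => w _; rewrite doubleS !subSS.
Qed.

(** [word] is injective with values in [words n], and there are [n`!] permutations
and as many words. *)
Lemma sum_word (V : nmodType) n (P : pred (seq nat)) (G : seq nat -> V) :
  (\sum_(p : 'S_n | P (word p)) G (word p) = \sum_(w <- words n | P w) G w)%R.
Proof.
have word_inj : injective (@word n).
  move=> p q /eq_in_map eq_pq; apply/permP => i; apply/val_inj.
  by have /eqP := eq_pq i (mem_enum _ i); rewrite eqSS => /eqP.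
rewrite -(big_map (@word n) P G); apply: perm_big.
have uniq_w : uniq [seq word p | p <- index_enum 'S_n].
  by rewrite map_inj_uniq // index_enum_uniq.
have sub : {subset [seq word p | p <- index_enum 'S_n] <= words n}.
  by move=> _ /mapP[p _ ->]; rewrite mem_words perm_word.
have size_w : size (words n) <= size [seq word p | p <- index_enum 'S_n].
  rewrite size_map /words size_permutations ?iota_uniq // size_iota.
  by rewrite -sum1_size sum1_card card_Sn.
apply: uniq_perm => //; first exact: permutations_uniq.
by have [] := uniq_min_size uniq_w sub size_w.
Qed.

Lemma sum_RS_BS (V : nmodType) n (F : nat -> V) :
  (\sum_(p in RS n) F (des (word p)).+1 =
   \sum_(p in BS n.+2) F (des (word p)))%R.
Proof.
have := sum_simsun_BS n F.
rewrite -(sum_word n (simsun n) (fun w => F (des w).+1)).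
rewrite -(sum_word n.+2 (fun w => simsun n.+2 w && succession_free n.+2 w)
                   (fun w => F (des w))) => eqF.
rewrite (eq_bigl (fun p : 'S_n => simsun n (word p))) => [|p]; last by rewrite inE.
by rewrite eqF; apply: eq_bigl => p; rewrite !inE.
Qed.

Theorem theorem2 :
  (forall n k : nat, k <= n./2 ->
     simsun_number n k = #|[set p in BS n.+2 | des (word p) == k.+1]|)
  /\
  (forall n : nat,
     simsun_poly n = (\sum_(p in BS n.+2) 'X^((des (word p)).-1))%R).
Proof.
split=> [n k _|n]; last exact: (sum_RS_BS n (fun d => 'X^(d.-1))%R).
have card_eq m (A : {set 'S_m}) j :
    #|[set p in A | des (word p) == j]| = \sum_(p in A) (des (word p) == j).
  by rewrite -sum1_card -big_mkcondr; apply: eq_bigl => p; rewrite inE.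
rewrite /simsun_number !card_eq.
exact: (sum_RS_BS n (fun d => nat_of_bool (d == k.+1))).
Qed.
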